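(* Let $\delta$ be a valley-free range map. The unital associative algebra $(\mathbf{Cl}_\delta,\cdot,\mathds{1})$ is free (as a unital associative algebra) if and only if $\delta$ is weakly increasing.
   Context: $\mathbb{K}$ is a field of characteristic zero, $\mathbb{N}=\{0,1,2,\dots\}$. A range map is a map $\delta:\mathbb{N}\setminus\{0\}\to\mathbb{N}$; it is weakly increasing if $\delta(i)\leq\delta(i+1)$ for all $i\geq1$, and valley-free if there are no $1\leq i_1<i_2<i_3$ with $\delta(i_1)>\delta(i_2)<\delta(i_3)$. A $\delta$-cliff is a finite word $u=u_1\cdots u_n$ of nonnegative integers with $u_i\leq\delta(i)$ for all $i$; $\mathsf{Cl}_\delta$ is the set of all of them, including the empty word $\epsilon$. $\mathbf{Cl}_\delta$ is the $\mathbb{K}$-vector space with basis $\{\mathsf{F}_u:u\in\mathsf{Cl}_\delta\}$. For a word $v\in\mathbb{N}^n$, $\mathrm{r}_\delta(v)_i:=\min\{v_i,\delta(i)\}$. The product is the bilinear map $\mathsf{F}_u\cdot\mathsf{F}_v=\sum_{v'}\mathsf{F}_{uv'}$, summed over all words $v'\in\mathbb{N}^{|v|}$ such that $\mathrm{r}_\delta(v')=v$ and $uv'\in\mathsf{Cl}_\delta$ ($uv'$ is the concatenation). The unit $\mathds{1}:\mathbb{K}\to\mathbf{Cl}_\delta$ sends $1$ to $\mathsf{F}_\epsilon$. For valley-free $\delta$ this is a unital associative algebra. *)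

(* Defs.v *)
From HB Require Import structures.
From mathcomp Require Import all_boot all_order all_algebra.
From mathcomp Require Import finmap.
From mathcomp.multinomials Require Import monalg.

Set Implicit Arguments.
Unset Strict Implicit.
Unset Printing Implicit Defensive.

Import GRing.Theory.
Local Open Scope ring_scope.

(* A range map is a function [delta : nat -> nat] of which only the values at
   positive arguments are used; [delta 0] is junk and never consulted. *)
Section RangeMaps.
Local Open Scope nat_scope.
Implicit Type delta : nat -> nat.

Definition weakly_increasing delta : Prop :=
  forall i, 1 <= i -> delta i <= delta i.+1.

Definition valley_free delta : Prop :=
  ~ exists i1 i2 i3,
      [/\ 1 <= i1, i1 < i2, i2 < i3, delta i2 < delta i1 & delta i2 < delta i3].

(* The letter u_i, 1 <= i <= |u|, is [nth 0 u i.-1]; hence the shifts. *)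
Definition is_cliff delta (u : seq nat) : bool :=
  [forall i : 'I_(size u), nth 0 u i <= delta i.+1].

Definition reduction delta (v : seq nat) : seq nat :=
  mkseq (fun i => minn (nth 0 v i) (delta i.+1)) (size v).

Record cliff delta : predArgType :=
  Cliff { cliff_word :> seq nat; _ : is_cliff delta cliff_word }.

HB.instance Definition _ delta := [isSub for @cliff_word delta].
HB.instance Definition _ delta := [Choice of cliff delta by <:].

Lemma is_cliff_nil delta : is_cliff delta [::].
Proof. by apply/forallP => -[]. Qed.

Definition empty_cliff delta : cliff delta := Cliff (is_cliff_nil delta).

Definition letter_bound delta n : nat := \max_(i < n) delta i.+1.

Lemma is_cliffP delta u :
  reflect (forall i, i < size u -> nth 0 u i <= delta i.+1) (is_cliff delta u).
Proof.
apply: (iffP forallP) => [h i lti|h i]; last exact: h.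
exact: (h (Ordinal lti)).
Qed.

Lemma size_reduction delta v : size (reduction delta v) = size v.
Proof. by rewrite size_mkseq. Qed.

Lemma nth_reduction delta v i :
  nth 0 (reduction delta v) i = minn (nth 0 v i) (delta i.+1).
Proof.
case: (ltnP i (size v)) => h; first by rewrite nth_mkseq.
by rewrite !nth_default ?size_reduction // min0n.
Qed.

Lemma reduction_cliff delta v : is_cliff delta (reduction delta v).
Proof. by apply/is_cliffP => i _; rewrite nth_reduction geq_minr. Qed.

Lemma reduction_id delta v : is_cliff delta v -> reduction delta v = v.
Proof.
move=> /is_cliffP h; apply: (@eq_from_nth _ 0); rewrite size_reduction // => i.
by move=> /h hi; rewrite nth_reduction; apply/minn_idPl.
Qed.

Lemma take_cliff delta k w : is_cliff delta w -> is_cliff delta (take k w).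
Proof.
move=> /is_cliffP h; apply/is_cliffP => i; rewrite size_take_min leq_min.
by move=> /andP[ik iw]; rewrite nth_take // h.
Qed.

Lemma take_reduction delta k v :
  take k (reduction delta v) = reduction delta (take k v).
Proof.
apply: (@eq_from_nth _ 0) => [|i].
  by rewrite size_reduction !size_take_min size_reduction.
rewrite size_take_min leq_min => /andP[ik _].
by rewrite nth_reduction !nth_take // nth_reduction.
Qed.

Lemma valley_freeP delta i1 i2 i3 : valley_free delta ->
  1 <= i1 -> i1 <= i2 -> i2 <= i3 -> delta i2 < delta i1 ->
  delta i3 <= delta i2.
Proof.
move=> vf h1 h12 h23 d21; rewrite leqNgt; apply/negP => d23; apply: vf.
exists i1, i2, i3; split=> //; rewrite ltn_neqAle ?h12 ?h23 andbT.
  by apply: contraTneq d21 => ->; rewrite ltnn.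
by apply: contraTneq d23 => ->; rewrite ltnn.
Qed.

Lemma reduction_drop delta j k w : valley_free delta -> is_cliff delta w ->
  reduction delta (drop k (reduction delta (drop j w)))
    = reduction delta (drop (j + k) w).
Proof.
move=> vf /is_cliffP h; apply: (@eq_from_nth _ 0) => [|i].
  by rewrite !(size_reduction, size_drop) subnDA.
rewrite !(size_reduction, size_drop) => lti.
rewrite !(nth_reduction, nth_drop) addnA.
case: (leqP (delta i.+1) (delta (k + i).+1)) => hd.
  by rewrite -minnA; congr minn; apply/minn_idPr.
congr minn; apply/minn_idPl; apply: (leq_trans (h _ _)).
  by rewrite -ltn_subRL subnDA.
apply: valley_freeP hd => //; first by rewrite ltnS leq_addl.
by rewrite ltnS -addnA leq_addl.
Qed.

End RangeMaps.

(* [cliff_alg K vf] is the K-vector space with basis the delta-cliffs.  The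
   proof [vf] of valley-freeness is a parameter of the type because it is
   needed for the product to be associative. *)
Definition cliff_alg (K : fieldType) (delta : nat -> nat)
    (vf : valley_free delta) : Type :=
  {malg K[cliff delta]}.

Section CliffAlgebra.
Variables (K : fieldType) (delta : nat -> nat).

Local Notation V := {malg K[cliff delta]}.

(* The basis element F_w, extended by 0 to the words w that are no cliffs. *)
Definition cliff_basis (w : seq nat) : V :=
  if insub w is Some c then << (c : cliff delta) >> else 0.

(* F_u . F_v.  The index type of the sum is finite, but loses no term: the
   letters of v' are bounded by [letter_bound] as soon as uv' is a cliff; see
   [cliff_mul_basis_coeff]. *)
Definition cliff_mul_basis (u v : cliff delta) : V :=
  \sum_(v' : (size v).-tuple 'I_(letter_bound delta (size u + size v)).+1
         | (reduction delta (map val v') == v)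
             && is_cliff delta (u ++ map val v'))
     cliff_basis (u ++ map val v').

Definition cliff_mul (x y : V) : V :=
  \sum_(u <- msupp x) \sum_(v <- msupp y)
     (x@_u * y@_v) *: cliff_mul_basis u v.

Definition cliff_one : V := << empty_cliff delta >>.

Lemma cliff_basis_coeff s (w : cliff delta) :
  (cliff_basis s)@_w = (s == w)%:R.
Proof.
rewrite /cliff_basis; case: insubP => [c _ <-|ns]; first by rewrite mcoeffU.
rewrite mcoeff0; case: eqP => // sw; case/negP: ns; rewrite sw.
exact: (valP w).
Qed.

Lemma cliff_mul_basis_coeff (u v w : cliff delta) :
  (cliff_mul_basis u v)@_w =
    ((take (size u) w == u) && (reduction delta (drop (size u) w) == v))%:R.
Proof.
rewrite /cliff_mul_basis raddf_sum /=; set b := letter_bound _ _.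
under eq_bigr do rewrite cliff_basis_coeff.
case: (boolP (_ && _)) => [/andP[/eqP wu /eqP wv]|nw]; last first.
  rewrite big1 // => t /andP[/eqP tv _]; case: eqP => // uw; case/negP: nw.
  by rewrite -uw take_size_cat // drop_size_cat // tv !eqxx.
have sw : size (drop (size u) w) = size v by rewrite -wv size_reduction.
have szw : size w = (size u + size v)%N.
  by rewrite -[w : seq nat](cat_take_drop (size u)) size_cat sw wu.
have /is_cliffP hw := valP w.
have lew a : a \in drop (size u) w -> (a < b.+1)%N.
  move=> /mem_drop /(nthP 0%N)[i iw <-]; rewrite ltnS.
  apply: leq_trans (hw i iw) _; rewrite szw in iw.
  exact: (leq_bigmax (Ordinal iw)).
have st : size (map (@inord b) (drop (size u) w)) == size v.
  by rewrite size_map sw.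
have ht : map val (Tuple st) = drop (size u) w.
  rewrite /= -map_comp -[RHS]map_id; apply/eq_in_map => a /lew ha /=.
  by rewrite inordK.
have hcat : u ++ drop (size u) w = w :> seq nat.
  by rewrite -[RHS](cat_take_drop (size u)) wu.
rewrite (bigD1 (Tuple st)) /= ?ht ?hcat ?eqxx ?wv ?eqxx ?(valP w) //=.
rewrite big1 ?addr0 // => t /andP[_ nt]; case: eqP => // tw; case/eqP: nt.
apply/val_inj/(inj_map val_inj); rewrite ht -tw drop_size_cat //.
Qed.

(* The coefficients of [x], extended by 0 to all words. *)
Let coefw (x : V) (s : seq nat) : K := if insub s is Some c then x@_c else 0.

Let coefwE x (w : cliff delta) : coefw x w = x@_w.
Proof. by rewrite /coefw valK. Qed.

Let coefw_sum x s :
  coefw x s = \sum_(u <- msupp x) x@_u * (s == u)%:R.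
Proof.
rewrite /coefw; case: insubP => [c _ <-|ns].
  rewrite {1}[x]monalgE raddf_sum; apply: eq_bigr => u _ /=.
  by rewrite mcoeffU mulr_natr -(inj_eq val_inj) /= eq_sym.
rewrite big1 // => u _; case: eqP => [su|_]; last by rewrite mulr0.
by case/negP: ns; rewrite su (valP u).
Qed.

Let cliff_mul_coeff x y (w : cliff delta) :
  (cliff_mul x y)@_w = \sum_(k < (size w).+1)
     coefw x (take k w) * coefw y (reduction delta (drop k w)).
Proof.
rewrite /cliff_mul raddf_sum /=.
under [RHS]eq_bigr => k _ do rewrite 2!coefw_sum big_distrlr /=.
rewrite exchange_big /=; apply: eq_bigr => u _.
rewrite raddf_sum exchange_big /=; apply: eq_bigr => v _.
rewrite mcoeffZ cliff_mul_basis_coeff.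
under eq_bigr do rewrite mulrACA -natrM mulnb.
rewrite -mulr_sumr; congr (_ * _).
case: (leqP (size u) (size w)) => [|] uw.
  rewrite (bigD1 (inord (size u))) //= inordK // big1 ?addr0 // => k nk.
  case: eqP => // ku; case/eqP: nk; apply: val_inj; rewrite /= inordK //.
  by rewrite -ku size_takel // -ltnS.
rewrite big1 => [|k _].
  by case: eqP => // h; rewrite -h size_take_min ltnNge geq_minr in uw.
by case: eqP => // h; rewrite -h size_take_min ltnNge geq_minr in uw.
Qed.

Let coefwM x y s : is_cliff delta s ->
  coefw (cliff_mul x y) s = \sum_(k < (size s).+1)
     coefw x (take k s) * coefw y (reduction delta (drop k s)).
Proof. by move=> cs; rewrite -[s]/(val (Cliff cs)) coefwE cliff_mul_coeff. Qed.

Let coefwD x y s : coefw (x + y) s = coefw x s + coefw y s.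
Proof. by rewrite /coefw; case: insub => [c|]; rewrite ?mcoeffD ?addr0. Qed.

Let coefwZ a x s : coefw (a *: x) s = a * coefw x s.
Proof. by rewrite /coefw; case: insub => [c|]; rewrite ?mcoeffZ ?mulr0. Qed.

Let coefw1 s : coefw cliff_one s = (s == [::])%:R.
Proof.
rewrite coefw_sum msuppU oner_eq0 big_seq_fset1 mcoeffUU mul1r.
by [].
Qed.

Lemma cliff_mulDl : left_distributive cliff_mul +%R.
Proof.
move=> x y z; apply/malgP => w; rewrite mcoeffD !cliff_mul_coeff -big_split /=.
by apply: eq_bigr => k _; rewrite coefwD mulrDl.
Qed.

Lemma cliff_mulDr : right_distributive cliff_mul +%R.
Proof.
move=> x y z; apply/malgP => w; rewrite mcoeffD !cliff_mul_coeff -big_split /=.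
by apply: eq_bigr => k _; rewrite coefwD mulrDr.
Qed.

Lemma cliff_mulZl (a : K) (x y : V) :
  a *: cliff_mul x y = cliff_mul (a *: x) y.
Proof.
apply/malgP => w; rewrite mcoeffZ !cliff_mul_coeff mulr_sumr.
by apply: eq_bigr => k _; rewrite coefwZ mulrA.
Qed.

Lemma cliff_mulZr (a : K) (x y : V) :
  a *: cliff_mul x y = cliff_mul x (a *: y).
Proof.
apply/malgP => w; rewrite mcoeffZ !cliff_mul_coeff mulr_sumr.
by apply: eq_bigr => k _; rewrite coefwZ mulrCA.
Qed.

Lemma cliff_mul1l : left_id cliff_one cliff_mul.
Proof.
move=> x; apply/malgP => w; rewrite cliff_mul_coeff big_ord_recl /=.
rewrite coefw1 take0 eqxx mul1r drop0 reduction_id ?(valP w) // coefwE.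
rewrite big1 ?addr0 // => k _; rewrite coefw1 -size_eq0.
by rewrite size_takel ?mul0r //= /bump leq0n.
Qed.

Lemma cliff_mul1r : right_id cliff_one cliff_mul.
Proof.
move=> x; apply/malgP => w; rewrite cliff_mul_coeff big_ord_recr /=.
rewrite take_size coefwE drop_size coefw1 eqxx mulr1.
rewrite big1 ?add0r // => k _; rewrite coefw1 -size_eq0 size_reduction.
by rewrite size_drop subn_eq0 leqNgt ltn_ord mulr0.
Qed.

Lemma cliff_one_neq0 : cliff_one != 0.
Proof. by rewrite monalgU_eq0 oner_eq0. Qed.

Hypothesis vf : valley_free delta.

Lemma cliff_mulA : associative cliff_mul.
Proof.
move=> x y z; apply/malgP => w; rewrite !cliff_mul_coeff.
pose F j k := coefw x (take j w)
   * (coefw y (reduction delta (drop j (take k w)))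
      * coefw z (reduction delta (drop k w))).
transitivity (\sum_(0 <= j < (size w).+1) \sum_(j <= k < (size w).+1) F j k).
  rewrite big_mkord; apply: eq_bigr => j _.
  rewrite coefwM ?reduction_cliff // size_reduction size_drop mulr_sumr.
  rewrite -[in RHS](add0n (j : nat)) big_addn subSn -1?ltnS // big_mkord add0n.
  apply: eq_bigr => k _; rewrite take_reduction take_drop.
  by rewrite reduction_drop ?(valP w) // /F [(j + k)%N]addnC.
transitivity (\sum_(0 <= k < (size w).+1) \sum_(0 <= j < k.+1) F j k).
  under eq_bigr do rewrite (@big_nat_widenl _ _ _ _ 0) //.
  rewrite (exchange_big_dep_nat xpredT) //=.
  rewrite [RHS]big_nat [LHS]big_nat; apply: eq_bigr => k /andP[_ kw].
  by rewrite [RHS](big_nat_widen _ _ (size w).+1).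
rewrite big_mkord; apply: eq_bigr => k _.
have kw : (k <= size w)%N by rewrite -ltnS.
rewrite coefwM ?take_cliff ?(valP w) // size_takel // mulr_suml big_mkord.
apply: eq_bigr => j _; rewrite /F mulrA take_takel //.
by rewrite -ltnS.
Qed.

End CliffAlgebra.

Section CliffAlgebraInstances.
Variables (K : fieldType) (delta : nat -> nat) (vf : valley_free delta).
Local Notation A := (cliff_alg K vf).

HB.instance Definition _ := GRing.Lmodule.copy A {malg K[cliff delta]}.
HB.instance Definition _ := GRing.Zmodule_isNzRing.Build A
  (@cliff_mulA K delta vf) (@cliff_mul1l K delta) (@cliff_mul1r K delta)
  (@cliff_mulDl K delta) (@cliff_mulDr K delta) (@cliff_one_neq0 K delta).
HB.instance Definition _ :=
  GRing.Lmodule_isLalgebra.Build K A (@cliff_mulZl K delta).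
HB.instance Definition _ :=
  GRing.Lalgebra_isAlgebra.Build K A (@cliff_mulZr K delta).
End CliffAlgebraInstances.

(* [{malg K[{fmonom X}]}] is the algebra of the free monoid on X, i.e. the free
   unital associative algebra K<X> of noncommutative polynomials. *)
Definition is_free_algebra (K : fieldType) (A : algType K) : Prop :=
  exists (X : choiceType) (f : {lrmorphism {malg K[{fmonom X}]} -> A}),
    bijective f.

(* Main.v *)
Require Import Defs.
From HB Require Import structures.
From mathcomp Require Import all_boot all_order all_algebra.
From mathcomp Require Import finmap zify.
From mathcomp.multinomials Require Import monalg.

(** If [delta i.+1 < delta i] for some [i >= 1], then the algebra has zero
    divisors: with [u] the one-letter cliff 0 and [v] the cliff of length [i]
    made of zeros followed by the letter [delta i], a term of F_u . F_v would
    have at position [i.+1] a letter that [delta i] truncates to [delta i],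
    hence a letter at least [delta i], which is above the bound [delta i.+1]
    ([descent_zero_divisors]).  A free algebra over a field is a domain
    ([free_algebra_domain]), so the algebra is not free.

    If [delta] is weakly increasing, then cliffs are closed under concatenation.
    They are closed under prefixes in any case, so each cliff is in a unique way
    a concatenation of prime cliffs, those nonempty cliffs which have no proper
    nonempty suffix that is a cliff ([prime_prod_inj], [prime_prod_surj]).  The
    basis elements of the prime cliffs generate the algebra freely, because a
    product of them is the basis element of the concatenation plus basis
    elements of cliffs of the same length and larger sum of letters
    ([prime_basis_prod_coeff]).  There are finitely many cliffs of a given
    length, so the evaluation map from the free algebra is unitriangular, hence
    bijective ([unitriangular_bijective]). *)

Set Implicit Arguments.
Unset Strict Implicit.
Unset Printing Implicit Defensive.

Import GRing.Theory.
Local Open Scope ring_scope.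

(** * Linear maps that are unitriangular on monomials *)

Section Support.
Variables (K : nzRingType) (C : choiceType).
Implicit Types (x : {malg K[C]}) (r : C -> nat).

Lemma msupp_argmax x r : x != 0 ->
  exists2 c, c \in msupp x & forall d, d \in msupp x -> (r d <= r c)%N.
Proof.
move=> xn0; have [c cx]: exists c, c \in msupp x.
  apply/fset0Pn; apply: contra_neq xn0 => sx0; apply/malgP => c.
  by rewrite mcoeff0 mcoeff_outdom // sx0.
case: (@arg_maxnP (msupp x) [` cx]%fset xpredT (fun d => r (val d))) => //.
move=> m _ mP.
by exists (val m) => [|d dx]; [exact: valP | exact: (mP [` dx]%fset)].
Qed.

Lemma malg_sumZ x : x = \sum_(c <- msupp x) x@_c *: << c >>.
Proof.
rewrite {1}[x]monalgE; apply: eq_bigr => c _.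
by apply/malgP => d; rewrite mcoeffZ !mcoeffU mulr_natr.
Qed.

End Support.

Section Unitriangular.
Variables (K : nzRingType) (C D : choiceType).
Variables (f : {linear {malg K[D]} -> {malg K[C]}}) (t : D -> C) (r : C -> nat).
Hypotheses (t_inj : injective t) (t_surj : forall c, exists d, t d = c).
Hypothesis f_diag : forall d, (f << d >>)@_(t d) = 1.
Hypothesis f_lower :
  forall d c, (f << d >>)@_c != 0 -> c = t d \/ (r c < r (t d))%N.

(** At a monomial [d] of maximal rank in the support of [x], no other monomial
    of [x] contributes to the coefficient of [f x] at [t d]. *)
Lemma unitriangular_injective : injective f.
Proof.
apply: raddf_inj => x fx0; apply/eqP; apply: contraT => xn0.
have [d dx dmax] := msupp_argmax (r \o t) xn0.
have: (f x)@_(t d) = 0 by rewrite fx0 mcoeff0.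
rewrite {1}[x]malg_sumZ !raddf_sum (bigD1_seq d) ?fset_uniq //=.
rewrite linearZ mcoeffZ f_diag mulr1 big_seq_cond big1 ?addr0 => [xd0|e].
  by move: dx; rewrite -mcoeff_neq0 xd0 eqxx.
case/andP=> ex ned; rewrite linearZ mcoeffZ.
have [->|/f_lower [/t_inj de|lt_de]] := eqVneq (f << e >>)@_(t d) 0.
- by rewrite mulr0.
- by rewrite de eqxx in ned.
- by have := dmax e ex; rewrite /= leqNgt lt_de.
Qed.

(** Modulo basis elements of smaller rank, the basis element at [t d] is
    [f << d >>]. *)
Lemma unitriangular_basis_preim n c :
  (r c < n)%N -> exists x, f x = << c >>.
Proof.
elim: n c => // n IHn c; rewrite ltnS => rc.
have [d td] := t_surj c; pose y := f << d >> - << c >>.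
have y_lt e : e \in msupp y -> (r e < n)%N.
  rewrite -mcoeff_neq0 mcoeffB mcoeffU -td => ye.
  have [te|nte] := eqVneq (t d) e.
    by move: ye; rewrite te eqxx -te f_diag subrr eqxx.
  move: ye; rewrite (negbTE nte) subr0 => /f_lower[ete|lt_e].
    by rewrite ete eqxx in nte.
  by rewrite (leq_trans lt_e) // td.
have [z fz]: exists z, f z = y.
  rewrite [y]malg_sumZ big_seq.
  apply: (big_ind (fun b => exists z, f z = b)).
  - by exists 0; rewrite raddf0.
  - by move=> _ _ [z1 <-] [z2 <-]; exists (z1 + z2); rewrite raddfD.
  - move=> e /y_lt /IHn[z fz]; exists (y@_e *: z).
    by rewrite linearZ; congr (_ *: _).
by exists (<< d >> - z); rewrite linearB fz /= /y opprB addrCA subrr addr0.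
Qed.

Lemma unitriangular_bijective : bijective f.
Proof.
have f_surj y : exists x, f x == y.
  rewrite [y]malg_sumZ.
  apply: (big_ind (fun b => exists x, f x == b)).
  - by exists 0; rewrite raddf0.
  - move=> _ _ [x1 /eqP<-] [x2 /eqP<-].
    by exists (x1 + x2); rewrite raddfD.
  - move=> c _; have [x fx] := unitriangular_basis_preim (ltnSn (r c)).
    by exists (y@_c *: x); rewrite linearZ fx.
have gK y : f (xchoose (f_surj y)) = y by apply/eqP/(xchooseP (f_surj y)).
exists (fun y => xchoose (f_surj y)) => // x.
by apply: unitriangular_injective; rewrite gK.
Qed.

End Unitriangular.

(** * Free algebras *)

Section FreeAlgebra.
Variable X : choiceType.

(** The product of the longest monomials of [x] and [y] arises in only one way,
    since a word splits uniquely into two words of prescribed lengths. *)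
Lemma free_algebra_domain (K : idomainType) (x y : {malg K[{fmonom X}]}) :
  x * y = 0 -> x = 0 \/ y = 0.
Proof.
move=> xy0; have [->|xn0] := eqVneq x 0; first by left.
have [->|yn0] := eqVneq y 0; first by right.
have [u ux umax] := msupp_argmax (@fdeg X) xn0.
have [v vy vmax] := msupp_argmax (@fdeg X) yn0.
have: (x * y)@_(mmul u v) = 0 by rewrite xy0 mcoeff0.
have splitting u' v' : u' \in msupp x -> v' \in msupp y ->
    (mmul u' v' == mmul u v) = (u' == u) && (v' == v).
  move=> u'x v'y; apply/eqP/andP => [e|[/eqP-> /eqP->] //].
  have /eqP := congr1 (@fmonom_val X) e; rewrite !fmM.
  have := congr1 (@fdeg X) e; rewrite !fdegM.
  move: (umax _ u'x) (vmax _ v'y); rewrite !fdegE => le_u le_v sz.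
  have szu : size u' = size u by lia.
  by rewrite eqseq_cat // => /andP[].
rewrite mcoeffMl (bigD1_seq u) ?fset_uniq //= (bigD1_seq v) ?fset_uniq //=.
rewrite eqxx mulr1n [X in _ + X + _]big_seq_cond.
rewrite [X in _ + X + _]big1 => [|v' /andP[v'y nv']].
  rewrite addr0 [X in _ + X]big_seq_cond big1 => [|u' /andP[u'x nu']].
    by rewrite addr0 => /eqP; rewrite mulf_eq0 !mcoeff_eq0 ux vy.
  rewrite big_seq big1 // => v' v'y.
  by rewrite splitting // (negbTE nu').
by rewrite splitting // (negbTE nv') andbF.
Qed.

Variables (K : fieldType) (A : algType K) (h : X -> A).

(** The universal property of the free algebra: [h] extends to a morphism of
    algebras, [free_eval]. *)
Definition fmonom_eval (m : {fmonom X}) : A := \prod_(i <- m) h i.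

Lemma fmonom_eval_mmorphism : mmorphism fmonom_eval.
Proof.
split=> [m1 m2|]; rewrite /fmonom_eval; first by rewrite fmM big_cat.
by rewrite fm1 big_nil.
Qed.

HB.instance Definition _ :=
  monalg.isMultiplicative.Build {fmonom X} A fmonom_eval fmonom_eval_mmorphism.

Definition free_eval : {malg K[{fmonom X}]} -> A :=
  mmap (GRing.in_alg A) fmonom_eval.

HB.instance Definition _ := GRing.Additive.on free_eval.

Lemma free_eval_scalable : scalable free_eval.
Proof. by move=> a x; rewrite /free_eval mmapZ mulr_algl. Qed.

HB.instance Definition _ :=
  GRing.isScalable.Build K {malg K[{fmonom X}]} A _ free_eval
    free_eval_scalable.

Lemma free_eval_multiplicative : multiplicative free_eval.
Proof.
apply: commr_mmap_is_multiplicative => x m m'.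
by rewrite /GRing.comm mulr_algl mulr_algr.
Qed.

HB.instance Definition _ :=
  GRing.isMultiplicative.Build {malg K[{fmonom X}]} A free_eval
    free_eval_multiplicative.

Lemma free_evalU m : free_eval << m >> = fmonom_eval m.
Proof. by rewrite /free_eval mmapU /= scale1r mul1r. Qed.

End FreeAlgebra.

Lemma is_free_algebra_domain (K : fieldType) (A : algType K) :
  is_free_algebra A -> forall a b : A, a * b = 0 -> a = 0 \/ b = 0.
Proof.
move=> [X [f [g fK gK]]] a b ab0.
have fgM : f (g a * g b) = 0 by rewrite rmorphM /= !gK.
have : g a * g b = 0 by apply: (can_inj fK); rewrite fgM raddf0.
by case/free_algebra_domain => /(congr1 f); rewrite gK raddf0; [left|right].
Qed.

(** * Products of cliffs *)

Section CliffProducts.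
Variables (K : fieldType) (delta : nat -> nat) (vf : valley_free delta).
Local Notation A := (cliff_alg K vf).
Local Notation F := (fun u : cliff delta => << u >> : A).

Lemma cliff_basisM_coeff (u : cliff delta) (y : A) (w : cliff delta) :
  (F u * y)@_w =
    (take (size u) w == u)%:R
      * y@_(Cliff (reduction_cliff delta (drop (size u) w))).
Proof.
rewrite -[F u * y]/(cliff_mul (F u) y) /cliff_mul.
rewrite msuppU oner_eq0 big_seq_fset1 mcoeffUU raddf_sum /=.
rewrite [in RHS](malg_sumZ y) raddf_sum mulr_sumr; apply: eq_bigr => v _ /=.
rewrite !mcoeffZ mul1r cliff_mul_basis_coeff mcoeffU -mulnb natrM mulrCA.
by rewrite -val_eqE /= [in RHS](eq_sym (v : seq nat)).
Qed.

(** At a descent [delta i > delta i.+1], the letter [delta i] is allowed at the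
    end of a cliff of length [i], but is too large to be moved one place to the
    right, as multiplication on the left by a one-letter cliff would do. *)
Lemma descent_zero_divisors i : (0 < i)%N -> (delta i.+1 < delta i)%N ->
  exists a b : A, [/\ a * b = 0, a <> 0 & b <> 0].
Proof.
case: i => // i _ desc.
have cu : is_cliff delta [:: 0%N] by apply/is_cliffP => -[].
have cv : is_cliff delta (rcons (nseq i 0%N) (delta i.+1)).
  apply/is_cliffP => j.
  rewrite size_rcons size_nseq nth_rcons size_nseq nth_nseq.
  by case: (ltngtP j i) => [//|//|->].
have F_neq0 c : F c <> 0.
  by apply/eqP; rewrite monalgU_eq0 oner_eq0.
exists (F (Cliff cu)), (F (Cliff cv)); split=> //.
apply/malgP => w; rewrite cliff_basisM_coeff mcoeffU mcoeff0 /= drop1.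
case: (Cliff cv =P _) => [/(congr1 val) /= redw|_]; last by rewrite mulr0.
have szw : size w = i.+2.
  have := congr1 size redw.
  rewrite size_rcons size_nseq size_reduction size_behead.
  by case: (size w) => //= k ->.
have /is_cliffP/(_ i.+1) := valP w; rewrite szw ltnS => /(_ (leqnn _)) wi.
have := congr1 (nth 0%N ^~ i) redw.
rewrite nth_rcons size_nseq ltnn eqxx nth_reduction nth_behead => e.
by move: desc wi; rewrite e /=; lia.
Qed.

End CliffProducts.

(** * Unique factorization of cliffs *)

Section Factorization.
Local Open Scope nat_scope.
Variable delta : nat -> nat.
Hypothesis delta_incr : weakly_increasing delta.

Lemma weakly_increasing_homo i j : 1 <= i -> i <= j -> delta i <= delta j.
Proof.
move=> i1 ij; rewrite -(subnKC ij).
elim: (j - i) => [|k IHk]; first by rewrite addn0.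
by rewrite addnS (leq_trans IHk) // delta_incr // (leq_trans i1) ?leq_addr.
Qed.

(** Concatenation moves the letters of [v] to the right, where the bounds are
    at least as large. *)
Lemma cat_cliff u v :
  is_cliff delta u -> is_cliff delta v -> is_cliff delta (u ++ v).
Proof.
move=> /is_cliffP cu /is_cliffP cv; apply/is_cliffP => i.
rewrite size_cat nth_cat => ltiw.
case: (ltnP i (size u)) => [/cu //|ui].
apply: (leq_trans (cv _ _)); first by lia.
by apply: weakly_increasing_homo; lia.
Qed.

Definition prime_cliff (w : cliff delta) : bool :=
  (0 < size w)
    && [forall k : 'I_(size w), (0 < k) ==> ~~ is_cliff delta (drop k w)].

Lemma prime_cliffP (w : cliff delta) :
  reflect (0 < size w /\
           forall u v, w = u ++ v :> seq nat -> is_cliff delta v ->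
             u = [::] \/ v = [::])
          (prime_cliff w).
Proof.
apply: (iffP andP) => -[w0 prw]; split=> //.
  move=> u v wuv cv.
  case: u v => [|a u] [|b v] in wuv cv *; [by left|by left|by right|].
  have ltu : size (a :: u) < size w by rewrite wuv size_cat /=; lia.
  have /forallP/(_ (Ordinal ltu))/implyP/(_ isT)/negP[] := prw.
  by rewrite -[drop _ _]/(drop (size (a :: u)) w) wuv drop_size_cat.
apply/forallP => k; apply/implyP => k0; apply/negP => ck.
have [] := prw _ _ (esym (cat_take_drop k w)) ck => /(congr1 size) /=.
  by rewrite size_take ltn_ord; lia.
by rewrite size_drop; have := ltn_ord k; lia.
Qed.

Definition primes : choiceType := {p : cliff delta | prime_cliff p}.

Definition prime_prod (m : seq primes) : seq nat :=
  flatten [seq cliff_word (val p) | p <- m].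

Lemma prime_prod_cliff m : is_cliff delta (prime_prod m).
Proof.
elim: m => [|p m IHm]; first exact: is_cliff_nil.
by apply: cat_cliff => //; apply: valP (val p).
Qed.

(** If [q] were longer than [p], then [q] would be [p] followed by a nonempty
    prefix of the cliff [s], and prefixes of cliffs are cliffs. *)
Lemma prime_prefix_eq (p q : primes) (s t : seq nat) :
  size (val p) <= size (val q) -> is_cliff delta s ->
  val p ++ s = val q ++ t :> seq nat -> p = q.
Proof.
case: p q => [p prp] [q prq] /= szpq cs pq; apply/val_inj/val_inj => /=.
have /prime_cliffP[_ q_prime] := prq.
have qE : q = p ++ take (size q - size p) s :> seq nat.
  have := congr1 (take (size q)) pq.
  by rewrite [RHS]take_size_cat // take_cat ltnNge szpq.
have [p0|r0] := q_prime _ _ qE (take_cliff _ cs); last by rewrite qE r0 cats0.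
by case/prime_cliffP: prp; rewrite p0.
Qed.

Lemma prime_prod_inj : injective prime_prod.
Proof.
have prime_neq_nil (p : primes) s : val p ++ s <> [::] :> seq nat.
  have /prime_cliffP[+ _] := valP p.
  by case: (cliff_word (val p)).
elim=> [|p m IHm] [|q l] //; rewrite /prime_prod /=.
- by move/esym/prime_neq_nil.
- by move/prime_neq_nil.
rewrite -!/(prime_prod _) => pq; have pqE : p = q.
  case: (leqP (size (val p)) (size (val q))) => [|/ltnW] szpq.
    exact: prime_prefix_eq szpq (prime_prod_cliff m) pq.
  by apply/esym; apply: prime_prefix_eq szpq (prime_prod_cliff l) (esym pq).
rewrite pqE; congr cons; apply: IHm; move/eqP: pq.
by rewrite pqE eqseq_cat // eqxx => /eqP.
Qed.

(** A nonempty cliff that is not prime can be cut before a suffix which is a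
    cliff, and both pieces are shorter cliffs. *)
Lemma prime_prod_surj (w : cliff delta) : exists m, prime_prod m = w.
Proof.
have [n] := ubnP (size w); elim: n w => // n IHn w; rewrite ltnS => szw.
have [prw|] := boolP (prime_cliff w).
  by exists [:: exist _ w prw]; rewrite /prime_prod /= cats0.
rewrite negb_and -eqn0Ngt => /orP[/eqP/size0nil ->|]; first by exists [::].
rewrite negb_forall => /existsP[k]; rewrite negb_imply negbK => /andP[k0 ck].
have [//|/= m1 m1E] := IHn (Cliff (take_cliff k (valP w))).
  by rewrite /= size_take ltn_ord (leq_trans (ltn_ord k)).
have [//|/= m2 m2E] := IHn (Cliff ck).
  by rewrite /= size_drop; have := ltn_ord k; lia.
exists (m1 ++ m2).
rewrite /prime_prod map_cat flatten_cat -!/(prime_prod _) m1E m2E.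
exact: cat_take_drop.
Qed.

(** * Leading terms *)

Lemma sumn_leqif (s t : seq nat) :
  size s = size t -> (forall i, nth 0 s i <= nth 0 t i) ->
  sumn s <= sumn t ?= iff (s == t).
Proof.
elim: s t => [|a s IHs] [|b t] //= [szst] le_st.
rewrite eqseq_cons; apply: leqif_add (leqif_eq (le_st 0)) (IHs t szst _).
by move=> i; exact: le_st i.+1.
Qed.

(** The rank for the unitriangularity argument: among the cliffs of one length,
    it decreases when the sum of the letters increases. *)
Definition slack (w : seq nat) : nat :=
  sumn (mkseq (fun i => delta i.+1) (size w)) - sumn w.

Lemma slack_lt (v w : cliff delta) :
  size w = size v -> sumn v < sumn w -> slack w < slack v.
Proof.
move=> szvw; rewrite /slack szvw => lt_vw; apply: ltn_sub2l => //.
apply: (leq_trans lt_vw); rewrite -szvw.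
apply: (leq_of_leqif (sumn_leqif _ _)); first by rewrite size_mkseq.
move=> i; case: (ltnP i (size w)) => [ltiw|leiw].
  by rewrite nth_mkseq //; apply: is_cliffP ltiw; apply: valP w.
by rewrite nth_default.
Qed.
End Factorization.

Section LeadingTerm.
Variables (K : fieldType) (delta : nat -> nat) (vf : valley_free delta).
Hypothesis delta_incr : weakly_increasing delta.
Local Notation A := (cliff_alg K vf).

Definition prime_basis (p : primes delta) : A := << val p >>.

Definition leading_cliff (m : {fmonom (primes delta)}) : cliff delta :=
  Cliff (prime_prod_cliff delta_incr m).

(** A term of the product F_p . F_v is [p ++ d] for a word [d] that reduces to
    [v].  Reduction can only lower letters, so [d] is [v] or has a larger
    sum. *)
Lemma prime_basis_prod_coeff (m : seq (primes delta)) (w : cliff delta) :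
  if prime_prod m == w then (\prod_(p <- m) prime_basis p : A)@_w = 1
  else (\prod_(p <- m) prime_basis p : A)@_w != 0 ->
    size w = size (prime_prod m) /\ (sumn (prime_prod m) < sumn w)%N.
Proof.
elim: m w => [|p m IHm] w /=.
  rewrite big_nil -[1]/(<< empty_cliff delta >> : A) mcoeffU -val_eqE /=.
  by case: eqP => //; rewrite eqxx.
rewrite big_cons cliff_basisM_coeff; set v := Cliff _; move: (IHm v) => {}IHm.
rewrite /prime_prod /= -/(prime_prod m).
case: ifP => [/eqP wE|nw].
  move: IHm; rewrite /= -wE take_size_cat // drop_size_cat //.
  by rewrite reduction_id ?prime_prod_cliff // !eqxx mul1r.
case: (take _ w =P _) => [takew|_]; last by rewrite mul0r eqxx.
rewrite mul1r => c0; move: IHm; set d := drop (size (val p)) w.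
have wE : w = val p ++ d :> seq nat by rewrite -takew cat_take_drop.
have [le_d eq_d] : (sumn v <= sumn d ?= iff (cliff_word v == d))%N.
  apply: sumn_leqif => [|i]; first by rewrite size_reduction.
  by rewrite nth_reduction geq_minl.
rewrite wE !size_cat !sumn_cat ltn_add2l.
have szv : size v = size d by rewrite size_reduction.
rewrite /=; case: ifP => [/eqP mE _|_ /(_ c0)[szm lt_m]]; last first.
  by rewrite -szv szm (leq_trans lt_m le_d).
rewrite mE szv; split=> //; rewrite ltn_neqAle le_d andbT eq_d.
by apply/eqP => vd; move: nw; rewrite wE -vd mE eqxx.
Qed.

Lemma weakly_increasing_free : is_free_algebra A.
Proof.
exists (primes delta), (free_eval prime_basis).
pose g : {linear {malg K[{fmonom (primes delta)}]} -> A} :=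
  free_eval prime_basis.
have gE m : g << m >> = \prod_(p <- m) prime_basis p by exact: free_evalU.
apply: (@unitriangular_bijective K _ _ g leading_cliff (@slack delta)).
- move=> m1 m2 /(congr1 val) /= /(prime_prod_inj delta_incr) e.
  exact: val_inj.
- move=> w; have [m mE] := prime_prod_surj w.
  by exists (FMonom m); apply: val_inj.
- move=> m; rewrite gE.
  have := prime_basis_prod_coeff m (leading_cliff m).
  by rewrite eqxx.
- move=> m w; rewrite gE; have := prime_basis_prod_coeff m w.
  case: ifP => [/eqP mw _ _|_ H /H[szw lt_w]]; first by left; apply: val_inj.
  by right; apply: slack_lt.
Qed.

End LeadingTerm.

Theorem lemma3p2p9 (K : fieldType) (pchar0 : [pchar K] =i pred0)
    (delta : nat -> nat) (vf : valley_free delta) :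
  is_free_algebra (cliff_alg K vf) <-> weakly_increasing delta.
Proof.
split; last exact: weakly_increasing_free.
move=> /is_free_algebra_domain domain i i_gt0.
rewrite leqNgt; apply/negP => desc.
have [a [b [ab0 a0 b0]]] := @descent_zero_divisors K delta vf i i_gt0 desc.
by case: (domain a b ab0).
Qed.
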